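(* Let $X$ be an absolutely continuous real random variable with cdf $F_X$ and pdf $f_X$, let $k\ge 1$ be an integer, and for each integer $n\ge1$ let $f_{L_{n,k}}$ be the pdf of the $n$th lower $k$-record value of $X$. Suppose that $f_X(x)$ is increasing in $x$ on the support of $X$. Then the Kerridge inaccuracy $H(f_{L_{n,k}},f_X)$ is increasing in $n$, i.e. $H(f_{L_{n,k}},f_X)\le H(f_{L_{n+1,k}},f_X)$ for every integer $n\ge1$.
   Context: The pdf of the $n$th lower $k$-record value $L_{n,k}$ is $f_{L_{n,k}}(x)=\frac{k^n}{(n-1)!}[-\log F_X(x)]^{n-1}[F_X(x)]^{k-1}f_X(x)$, $x\in\mathbb R$, where $n,k$ are positive integers and $\log$ is the natural logarithm. The Kerridge inaccuracy measure between $L_{n,k}$ and the parent variable $X$ is $H(f_{L_{n,k}},f_X)=-\int_{-\infty}^{\infty} f_{L_{n,k}}(x)\log f_X(x)\,dx$, with the convention that the integrand is $0$ where $f_X(x)=0$. The support of $X$ is an interval on which $f_X>0$. ''Increasing'' is meant in the weak sense. The inaccuracy measures are assumed to be well defined (the integrals exist as extended real numbers) for all $n\geq 1$. *)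

(* Defs.v *)
From HB Require Import structures.
From mathcomp Require Export all_boot all_order all_algebra.
From mathcomp Require Export all_classical all_reals all_analysis.

Set Implicit Arguments.
Unset Strict Implicit.
Unset Printing Implicit Defensive.

Export Order.TTheory GRing.Theory Num.Theory.
Export numFieldNormedType.Exports.

Local Open Scope classical_set_scope.
Local Open Scope ring_scope.

(* Such an f exists exactly when X is absolutely continuous. A fixed version
   of the density is used, since monotonicity of f is a pointwise property. *)
Definition is_pdf (d : measure_display) (T : measurableType d) (R : realType)
    (P : probability T R) (X : {RV P >-> R}) (f : R -> R) : Prop :=
  [/\ measurable_fun [set: R] f,
      (forall x, 0 <= f x) &
      (forall A : set R, measurable A ->
        distribution P X A = \int[lebesgue_measure]_(x in A) (f x)%:E)%E].

Definition pdf_support (R : realType) (f : R -> R) : set R :=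
  [set x | 0 < f x].

(* F and f are the cdf and pdf of the parent variable; meaningful for n, k >= 1.
   Since ln 0 = 0 in the library, the factor (- ln (F x)) ^+ n.-1 has a junk
   value where F x = 0; as f vanishes almost everywhere on that set, only a
   Lebesgue-null set of points is affected. *)
Definition lower_record_pdf (R : realType) (F f : R -> R) (k n : nat) (x : R)
    : R :=
  k%:R ^+ n / (n.-1)`!%:R * (- ln (F x)) ^+ n.-1 * F x ^+ k.-1 * f x.

(* Since ln 0 = 0 in the library, this is 0 wherever g x = 0. *)
Definition kerridge_integrand (R : realType) (f g : R -> R) (x : R) : \bar R :=
  (f x * ln (g x))%:E.

Definition kerridge (R : realType) (f g : R -> R) : \bar R :=
  (- \int[lebesgue_measure]_x kerridge_integrand f g x)%E.

(* The integral exists in the extended reals: its positive and negative parts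
   are not both infinite (in the library, +oo - +oo would be -oo). *)
Definition kerridge_well_defined (R : realType) (f g : R -> R) : Prop :=
  ((\int[lebesgue_measure]_x (kerridge_integrand f g)^\+ x < +oo) \/
   (\int[lebesgue_measure]_x (kerridge_integrand f g)^\- x < +oo))%E.

(* Main.v *)
(* The ratio f_{L_n.+1} / f_{L_n} = (k / n) (- ln F) is nonincreasing and
   crosses 1 at a point x0 of the support with F x0 = exp (- n / k), while ln f
   is nondecreasing there.  Hence (f_{L_n.+1} - f_{L_n}) (ln f - ln (f x0)) <= 0,
   and integrating this gives the inequality, since all the f_{L_n} have the
   same finite integral.  The latter holds because - ln (F X) has the standard
   exponential law (F is continuous as X has a density), which turns the
   integral of f_{L_n} into that of an Erlang density. *)

From HB Require Import structures.
Require Import Defs.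
From mathcomp Require Import measurable_realfun ring lra.

Set Implicit Arguments.
Unset Strict Implicit.
Unset Printing Implicit Defensive.

Local Open Scope classical_set_scope.
Local Open Scope ring_scope.

(** * Integration against a measure given by a density *)

Section with_density.
Context d (T : measurableType d) (R : realType).
Variables (mu nu : {measure set T -> \bar R}) (p : T -> R).
Hypothesis mp : measurable_fun [set: T] p.
Hypothesis p_ge0 : forall x, 0 <= p x.
Hypothesis nuE : forall A, measurable A ->
  (nu A = \int[mu]_(x in A) (p x)%:E)%E.

Local Open Scope ereal_scope.

Import HBNNSimple.

Lemma integral_indic_density (A : set T) : measurable A ->
  \int[nu]_x (\1_A x)%:E = \int[mu]_x (\1_A x * p x)%:E.
Proof.
move=> mA; rewrite integral_indic// setIT nuE// integral_mkcond.
apply: eq_integral => x _; rewrite patchE indicE.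
by case: ifPn => _; rewrite ?mul1r ?mul0r.
Qed.

(** A simple function is the finite sum of [r] times the indicator of its fibre over [r], so
    additivity reduces the claim to indicators. *)
Lemma integral_nnsfun_density (g : {nnsfun T >-> R}) :
  \int[nu]_x (g x)%:E = \int[mu]_x (g x * p x)%:E.
Proof.
under [LHS]eq_integral do rewrite fimfunE -fsumEFin//.
rewrite [LHS]ge0_integral_fsum//; last 2 first.
  - by move=> r; exact/measurable_EFinP/measurableT_comp.
  - by move=> r x _; rewrite EFinM nnfun_muleindic_ge0.
under [RHS]eq_integral.
  move=> x _; rewrite EFinM fimfunE -fsumEFin// ge0_mule_fsuml; last first.
    by move=> r; rewrite EFinM nnfun_muleindic_ge0.
  over.
rewrite [RHS]ge0_integral_fsum//; last 2 first.
  - move=> r; apply/measurable_EFinP; apply: measurable_funM => //.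
    exact: measurableT_comp.
  - by move=> r x _; rewrite EFinM mule_ge0 ?nnfun_muleindic_ge0 ?lee_fin.
apply: eq_fsbigr => r _.
(* Pulling [r] out of the integrals requires [0 <= r]; for [r < 0] the fibre is empty because [g] is
   nonnegative, and both integrals vanish. *)
have [r0|r0] := leP 0%R r; last first.
  have g_r : g @^-1` [set r] = set0.
    apply/seteqP; split => // x /= gxr; move: r0.
    by rewrite ltNge -gxr fun_ge0.
  rewrite !integral0_eq// => x _; rewrite g_r indic0 mulr0//.
  by rewrite mul0e.
under eq_integral do rewrite EFinM.
rewrite ge0_integralZl//; last exact/measurable_EFinP/measurable_indic.
under [RHS]eq_integral do rewrite !EFinM -muleA.
rewrite [RHS]ge0_integralZl//.
- by rewrite integral_indic_density//; under eq_integral do rewrite EFinM.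
- by apply: emeasurable_funM; exact/measurable_EFinP.
- by move=> x _; rewrite mule_ge0// lee_fin.
Qed.

(** Monotone convergence along simple approximations of [g], applied once for [nu] and once for
    [mu]; since [p] is nonnegative, the products with [p] increase as well. *)
Lemma ge0_integral_density (g : T -> R) :
  measurable_fun [set: T] g -> (forall x, (0 <= g x)%R) ->
  \int[nu]_x (g x)%:E = \int[mu]_x (g x * p x)%:E.
Proof.
move=> mg g0.
have mEg : measurable_fun [set: T] (EFin \o g) by exact/measurable_EFinP.
pose g_ := nnsfun_approx measurableT mEg.
have g_cvg x : (g_ n x)%:E @[n --> \oo] --> (g x)%:E.
  by apply: cvg_nnsfun_approx => // y _; rewrite lee_fin.
transitivity (lim (\int[nu]_x (g_ n x)%:E @[n --> \oo])).
  rewrite -monotone_convergence//=.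
  - by apply: eq_integral => x _; apply/esym/cvg_lim.
  - by move=> n; exact/measurable_EFinP/measurable_funTS.
  - by move=> n ? _; rewrite lee_fin.
  - by move=> ? _ ? ? mn; rewrite lee_fin; exact/lefP/nd_nnsfun_approx.
under eq_fun do rewrite integral_nnsfun_density.
rewrite -monotone_convergence//=.
- apply: eq_integral => x _; apply/cvg_lim => //.
  under eq_fun do rewrite EFinM.
  rewrite EFinM; apply: cvgeM => //; last exact: cvg_cst.
- by move=> n; apply/measurable_EFinP/measurable_funM.
- by move=> n ? _; rewrite lee_fin mulr_ge0.
- move=> x _ ? ? mn; rewrite lee_fin ler_wpM2r//.
  exact/lefP/nd_nnsfun_approx.
Qed.

End with_density.

(** * Comparison of possibly infinite integrals *)

Section le_integral_perturbed.
Context d (T : measurableType d) (R : realType).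
Variables (mu : {measure set T -> \bar R}) (u v e : T -> R).

Local Open Scope ereal_scope.

(* Integrating u^+ + v^- + e^- <= v^+ + u^- + e^+ only involves nonnegative
   functions, so the integrals of u and v may be infinite. *)
Lemma le_integral_perturbed :
  measurable_fun [set: T] u -> measurable_fun [set: T] v ->
  mu.-integrable [set: T] (EFin \o e) -> \int[mu]_x (e x)%:E = 0 ->
  {ae mu, forall x, (u x <= v x + e x)%R} ->
  \int[mu]_x (EFin \o u)^\+ x < +oo \/ \int[mu]_x (EFin \o u)^\- x < +oo ->
  \int[mu]_x (EFin \o v)^\+ x < +oo \/ \int[mu]_x (EFin \o v)^\- x < +oo ->
  \int[mu]_x (u x)%:E <= \int[mu]_x (v x)%:E.
Proof.
move=> mu_ mv ie e0 uve.
pose pos (w : T -> R) : \bar R := \int[mu]_x (EFin \o w)^\+ x.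
pose neg (w : T -> R) : \bar R := \int[mu]_x (EFin \o w)^\- x.
rewrite -/(pos u) -/(neg u) -/(pos v) -/(neg v) => wu wv.
have pos_ge0 w : 0 <= pos w by apply: integral_ge0.
have neg_ge0 w : 0 <= neg w by apply: integral_ge0.
have pose_fin : pos e \is a fin_num.
  exact: integral_fune_fin_num (integrable_funepos _ ie).
have nege_fin : neg e \is a fin_num.
  exact: integral_fune_fin_num (integrable_funeneg _ ie).
have eq_e : pos e = neg e.
  move: e0; rewrite integralE -/(pos e) -/(neg e) -(fineK pose_fin).
  by rewrite -(fineK nege_fin) -EFinB => -[] /subr0_eq ->.
have mp (w : T -> R) : measurable_fun [set: T] w ->
    measurable_fun [set: T] (EFin \o w)^\+.
  by move=> mw; apply/measurable_funepos/measurable_EFinP.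
have mn (w : T -> R) : measurable_fun [set: T] w ->
    measurable_fun [set: T] (EFin \o w)^\-.
  by move=> mw; apply/measurable_funeneg/measurable_EFinP.
have /measurable_EFinP me := measurable_int mu ie.
(* As [e] has integral zero, [pos e] and [neg e] are the same finite number; it is added to both
   sides and split between them as the pointwise bound requires. *)
have key : pos u + neg v <= pos v + neg u.
  rewrite -(@leeD2rE _ (neg e))// -[in leRHS]eq_e /pos /neg.
  rewrite -!ge0_integralD//; try by [exact: mp|exact: mn|
    apply: emeasurable_funD; by [exact: mp|exact: mn]|
    move=> x _; exact: adde_ge0].
  apply: ae_ge0_le_integral => //.
  - by move=> x _; rewrite !adde_ge0.
  - by apply: emeasurable_funD; [apply: emeasurable_funD|];
      by [exact: mp|exact: mn].
  - by move=> x _; rewrite !adde_ge0.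
  - by apply: emeasurable_funD; [apply: emeasurable_funD|];
      by [exact: mp|exact: mn].
  apply: filterS uve => x uve _; rewrite !funeposE !funenegE/=.
  rewrite -!EFin_max -!EFinD lee_fin.
  have maxBN (a : R) : (Num.max a 0 - Num.max (- a) 0 = a)%R.
    by rewrite !maxEle; do !case: ifP; lra.
  move: (maxBN (u x)) (maxBN (v x)) (maxBN (e x)); lra.
rewrite [leLHS]integralE [leRHS]integralE.
rewrite -/(pos u) -/(neg u) -/(pos v) -/(neg v).
move: (pos u) (neg u) (pos v) (neg v) (pos_ge0 u) (neg_ge0 u) (pos_ge0 v)
  (neg_ge0 v) wu wv key.
(* Well-definedness excludes the differences of two infinities; with four finite values [key] is the
   claim rearranged. *)
move=> [a| |] [b| |] [c| |] [f| |]//= _ _ _ _ wu wv key;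
  rewrite ?leey ?leNye//; try by [case: wu|case: wv].
by move: key; rewrite !lee_fin; lra.
Qed.

End le_integral_perturbed.

(** * Total mass of the Erlang density *)

Section erlang.
Variables (R : realType) (r : R).
Hypothesis r_gt0 : 0 < r.

(** After rescaling by [r], the bound x^(n+1) / (n+1)! <= exp x gives x^n exp (-x) <= (n+1)! / x,
    and squeezing concludes. *)
Lemma cvg_exprM_expRN n : (r * x) ^+ n * expR (- (r * x)) @[x --> +oo] --> 0.
Proof.
suff : x ^+ n * expR (- x) @[x --> +oo] --> (0 : R).
  move=> h; apply: (@cvg_comp _ _ _ (fun x : R => r * x)
    (fun x : R => x ^+ n * expR (- x)) _ (pinfty_nbhs R)) => //.
  exact: gt0_cvgMry.
apply: (@squeeze_cvgr _ _ _ _ (cst 0) (fun x : R => n.+1`!%:R * x^-1)).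
- near=> x.
  have x0 : 0 < x by near: x; exact: nbhs_pinfty_gt.
  rewrite mulr_ge0 ?exprn_ge0 ?expR_ge0 ?(ltW x0)//=.
  rewrite expRN ler_pdivrMr ?expR_gt0//.
  have := expR_ge1Dxn n (ltW x0).
  set E := expR x => hE.
  have /= hE' : x ^+ n.+1 / n.+1`!%:R <= E by apply: le_trans hE; rewrite lerDr.
  move: hE'; rewrite ler_pdivrMr ?ltr0n ?fact_gt0// exprS => hE'.
  rewrite mulrAC ler_pdivlMr// mulrC (le_trans hE')// mulrC//.
- exact: cvg_cst.
- rewrite -[X in _ --> X](mulr0 n.+1`!%:R); apply: cvgM; first exact: cvg_cst.
  apply/gtr0_cvgV0; last exact: cvg_id.
  exact: nbhs_pinfty_gt.
Unshelve. all: by end_near. Qed.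

Let H n (x : R) := r ^+ n.+1 / n`!%:R * x ^+ n * expR (- (r * x)).
(* The derivative of G n.+1 is H n - H n.+1 and that of G 0 is - H 0, so F n,
   minus the sum of the G j for j <= n, is a primitive of H n. *)
Let G n (x : R) := n`!%:R^-1 * ((r * x) ^+ n * expR (- (r * x))).
Let F n (x : R) := - \sum_(j < n.+1) G j x.

Let is_derive_rx (x : R) : is_derive x 1 (fun y : R => r * y) r.
Proof.
have -> : (fun y : R => r * y) = r \*: id by [].
by apply: is_derive_eq; rewrite /GRing.scale/= mulr1.
Qed.

Let is_derive_expRN (x : R) :
  is_derive x 1 (fun y : R => expR (- (r * y))) (- r * expR (- (r * x))).
Proof.
rewrite mulrC; apply: (@is_derive1_comp _ expR (fun y => - (r * y))).
exact: is_deriveN.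
Qed.

Let is_derive_G0 (x : R) : is_derive x 1 (G 0) (- H 0 x).
Proof.
rewrite /G /H fact0.
have -> : (fun x => 1%:R^-1 * ((r * x) ^+ 0 * expR (- (r * x)))) =
    (fun y : R => expR (- (r * y))).
  by apply/funext => y; rewrite invr1 !mul1r.
by apply: (is_derive_eq (is_derive_expRN x)); rewrite expr1 divr1 mulr1 mulNr.
Qed.

Let is_derive_GS n (x : R) : is_derive x 1 (G n.+1) (H n x - H n.+1 x).
Proof.
rewrite /G /H.
have := is_deriveM (is_deriveX n.+1 (is_derive_rx x)) (is_derive_expRN x).
move=> /(is_deriveZ (n.+1`!%:R^-1)) dG.
have -> : (fun x => n.+1`!%:R^-1 * ((r * x) ^+ n.+1 * expR (- (r * x)))) =
    n.+1`!%:R^-1 \*: ((fun y : R => r * y) ^+ n.+1 *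
      (fun y : R => expR (- (r * y)))).
  by apply/funext => y; rewrite !fctE.
apply: (is_derive_eq dG) => {dG}.
rewrite /GRing.scale/= ?fctE factS natrM !exprMn !exprS.
by field; rewrite nat1r !pnatr_eq0 -!lt0n fact_gt0.
Qed.

Let is_derive_F n (x : R) : is_derive x 1 (F n) (H n x).
Proof.
elim: n => [|n IHn].
  have -> : F 0 = - G 0 by apply/funext => y; rewrite /F big_ord1.
  by apply: (is_derive_eq (is_deriveN (is_derive_G0 x))); rewrite opprK.
have -> : F n.+1 = F n - G n.+1.
  by apply/funext => y; rewrite /F big_ord_recr/= opprD.
apply: (is_derive_eq (is_deriveB IHn (is_derive_GS n x))).
by rewrite opprB addrC subrK.
Qed.

Let cvg_G n : G n x @[x --> +oo] --> 0.
Proof.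
rewrite -[X in _ --> X](mulr0 (n`!%:R^-1)); apply: cvgM; first exact: cvg_cst.
exact: cvg_exprM_expRN.
Qed.

Let cvg_F n : F n x @[x --> +oo] --> 0.
Proof.
elim: n => [|n IHn].
  have -> : F 0 = - G 0 by apply/funext => y; rewrite /F big_ord1.
  by rewrite -oppr0; apply: cvgN; exact: cvg_G.
have -> : F n.+1 = F n - G n.+1.
  by apply/funext => y; rewrite /F big_ord_recr/= opprD.
by rewrite -[X in _ --> X](subrr 0); apply: cvgB => //; exact: cvg_G.
Qed.

(** The primitive [F n] tends to 0 at infinity and equals -1 at 0, where every [G j] with [j > 0]
    vanishes and [G 0] is 1. *)
Lemma integral_erlang n :
  (\int[lebesgue_measure]_(x in `[0%R, +oo[)
    (r ^+ n.+1 / n`!%:R * x ^+ n * expR (- (r * x)))%:E = 1)%E.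
Proof.
have dF x : derivable (F n) x 1 by have [] := is_derive_F n x.
have cF : continuous (F n).
  by move=> x; exact/differentiable_continuous/derivable1_diffP.
rewrite (@ge0_continuous_FTC2y _ (H n) (F n) 0 0).
- rewrite /F (bigD1 ord0)//= big1 ?addr0; last first.
    by move=> [[|i] ?]//= _; rewrite /G/= mulr0 expr0n/= mul0r mulr0.
  by rewrite /G mulr0 oppr0 expR0 fact0 expr0 invr1 !mulr1 -EFinB opprK add0r.
- move=> x x0; rewrite /H !mulr_ge0 ?expR_ge0 ?exprn_ge0 ?invr_ge0//.
  exact: ltW.
- apply: continuous_subspaceT => x.
  apply: (@continuousM _ R^o (fun x => r ^+ n.+1 / n`!%:R * x ^+ n)
    (fun x : R => expR (- (r * x)))).
    apply: (@continuousM _ R^o (fun=> r ^+ n.+1 / n`!%:R) (fun x => x ^+ n)).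
      exact: cst_continuous.
    exact: exprn_continuous.
  apply/differentiable_continuous/derivable1_diffP.
  by have [] := is_derive_expRN x.
- exact: cvg_F.
- by [].
- exact/cvg_at_right_filter/cF.
- by move=> x _; rewrite derive1E; apply: derive_val.
Qed.

End erlang.

(** * The standard exponential law is determined by its tails *)

Section exponential_law.
Variable (R : realType).

Lemma exponential_prob1_itvoy (t : R) : 0 <= t ->
  exponential_prob 1 `]t, +oo[ = (expR (- t))%:E.
Proof.
move=> t0; rewrite /exponential_prob.
under eq_integral => x.
  rewrite inE/= in_itv/= andbT => tx.
  rewrite exponential_pdfE ?(le_trans t0 (ltW tx))// mul1r mulN1r.
  over.
have d (x : R) : is_derive x 1 (fun y : R => - expR (- y)) (expR (- x)).
  have dx := is_deriveN
    (is_derive1_comp (is_derive_expR (- x)) (is_deriveNid x 1)).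
  by apply: (is_derive_eq dx); rewrite mulrN1 opprK.
have c (x : R) : {for x, continuous (fun y : R => - expR (- y))}.
  by apply/differentiable_continuous/derivable1_diffP; have [] := d x.
rewrite integral_itv_obnd_cbnd; last first.
  by apply/measurable_EFinP/measurable_funTS; apply: measurableT_comp.
rewrite (@ge0_continuous_FTC2y _ _ (fun y : R => - expR (- y)) _ 0)//.
- by rewrite -EFinB opprK add0r.
- apply: continuous_subspaceT => x.
  apply: (@continuous_comp _ _ _ -%R); last exact: continuous_expR.
  exact: opp_continuous.
- by rewrite -oppr0; apply: cvgN; exact: cvgr_expR.
- exact/cvg_at_right_filter/c.
- by move=> x _; rewrite derive1E; apply: derive_val.
Qed.

(** Open upper half-lines are stable under intersection and generate the Borel sets, so two
    probabilities agreeing on them are equal. *)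
Lemma exponential_law (nu : probability (measurableTypeR R) R) :
  (forall t, 0 <= t -> nu `]t, +oo[%classic = (expR (- t))%:E) ->
  forall A, measurable A -> nu A = exponential_prob 1 A.
Proof.
move=> nuE A mA.
(* Tails at negative [t] are not given by the formula; they are squeezed between the tail at 0,
   which is already 1, and the total mass. *)
have le1 (m : probability (measurableTypeR R) R) (t : R) : t < 0 ->
    m `]0, +oo[%classic = 1%E -> m `]t, +oo[%classic = 1%E.
  move=> t0 m0; apply/eqP; rewrite eq_le probability_le1//= -[leLHS]m0.
  rewrite le_measure ?inE// => x /=; rewrite !in_itv/= !andbT.
  exact: lt_trans.
apply: (@measure_unique _ R (measurableTypeR R) (@RGenOInfty.G R)
  (fun k => `]- k%:R, +oo[%classic) _ _ _ _ nu (exponential_prob 1)) => //.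
- exact: RGenOInfty.measurableE.
- move=> _ _ [x ->] [y ->]; exists (Num.max x y).
  apply/seteqP; split => z/=; rewrite !in_itv/= !andbT gt_max.
    by case => -> ->.
  by move=> /andP.
- by move=> i; exists (- i%:R).
- rewrite -subTset => x _; exists (Num.bound x) => //=.
  by rewrite in_itv/= andbT ltrNl unstable.ltrNbound.
- move=> _ [t ->].
  have [t0|t0] := leP 0 t.
    exact: etrans (nuE t t0) (esym (exponential_prob1_itvoy t0)).
  have e0 : (expR (- (0 : R)))%:E = 1%E by rewrite oppr0 expR0.
  apply: (etrans (le1 nu t t0 (etrans (nuE 0 (lexx 0)) e0))); apply/esym.
  apply: (le1 (exponential_prob 1) t t0).
  exact: etrans (exponential_prob1_itvoy (lexx 0)) e0.
- by move=> k; rewrite (le_lt_trans (probability_le1 _ _))// ltry.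
Qed.

End exponential_law.

(** * Continuity of the cdf and the law of [- ln (F X)] *)

Section cdf_of_pdf.
Context d (T : measurableType d) (R : realType) (P : probability T R).
Variables (X : {RV P >-> R}) (f : R -> R).
Hypothesis f_pdf : is_pdf X f.

Local Notation mu := (@lebesgue_measure R).
Local Notation F x := (fine (cdf X x)).

Let cdfE (x : R) : cdf X x = (F x)%:E.
Proof. by rewrite fineK// fin_num_measure. Qed.

Lemma fine_cdf_ge0 (x : R) : 0 <= F x.
Proof. exact: fine_ge0. Qed.

Lemma fine_cdf_le1 (x : R) : F x <= 1.
Proof. by rewrite -lee_fin -cdfE cdf_le1. Qed.

Lemma fine_cdf_nd (x y : R) : x <= y -> F x <= F y.
Proof. by move=> xy; rewrite -lee_fin -!cdfE cdf_nondecreasing. Qed.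

Lemma distribution_itvoc (x y : R) : x <= y ->
  distribution P X `]x, y] = (F y - F x)%:E.
Proof.
move=> xy; rewrite EFinB -!cdfE.
have -> : `]x, y]%classic = `]-oo, y] `\` `]-oo, x].
  by rewrite -[RHS]setCK setCD setCitvl setUC -[LHS]setCK setCitv.
rewrite measureD ?setIidr//; first exact: subset_itvl.
by rewrite -ge0_fin_numE// fin_num_measure.
Qed.

Let mf : measurable_fun [set: R] f. Proof. by case: f_pdf. Qed.
Let f_ge0 (x : R) : 0 <= f x. Proof. by case: f_pdf. Qed.
Let fE (A : set R) : measurable A ->
  (distribution P X A = \int[mu]_(x in A) (f x)%:E)%E.
Proof. by case: f_pdf => _ _; exact. Qed.

Lemma integrable_pdf : mu.-integrable [set: R] (EFin \o f).
Proof.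
apply/integrableP; split; first exact/measurable_EFinP.
under eq_integral do rewrite /= ger0_norm//.
by rewrite -fE// (le_lt_trans (probability_le1 _ _))// ltry.
Qed.

(** On the segment, [F x] is [F a] plus the integral of [f] from [a] to [x], which is continuous in
    its upper bound. *)
Lemma continuous_fine_cdf (a b : R) : a <= b ->
  {within `[a, b], continuous (fun x : R => F x)}.
Proof.
move=> ab.
have intf : mu.-integrable `[a, b] (EFin \o f).
  exact: integrableS integrable_pdf.
have h := parameterized_integral_continuous ab intf.
have : {within `[a, b], continuous
    (fun x => F a + (\int[mu]_(t in `[a, x]) (f t))%R)}.
  move=> x; apply: cvgD; [exact: cvg_cst|exact: h].
apply: subspace_eq_continuous => x /[!inE]/= /[!in_itv]/= /andP[ax xb].
rewrite /from_subspace /Rintegral -integral_itv_obnd_cbnd; last first.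
  exact/measurable_EFinP/measurable_funTS.
rewrite -fE// distribution_itvoc//=.
by rewrite addrC subrK.
Qed.

Lemma fine_cdf_surj (u : R) : 0 < u < 1 -> exists x : R, F x = u.
Proof.
move=> /andP[u0 u1].
have /fine_cvg FNy := cvg_cdfNy0 X.
have /fine_cvg Fy := cvg_cdfy1 X.
have [a /= Fa] := filter_ex (cvgr_lt _ FNy _ u0).
have [b /= Fb] := filter_ex (cvgr_gt _ Fy _ u1).
have ab : a <= b.
  rewrite leNgt; apply/negP => ba.
  by have := fine_cdf_nd (ltW ba); rewrite leNgt (lt_trans Fa Fb).
have [|c _ Fc] := IVT ab (continuous_fine_cdf ab) (v := u); last by exists c.
by rewrite ge_min le_max (ltW Fa) (ltW Fb) orbT.
Qed.

Lemma measurable_fine_cdf : measurable_fun [set: R] (fun x : R => F x).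
Proof.
apply/measurable_EFinP; rewrite (_ : _ \o _ = cdf X).
  exact: cdf_measurable.
by apply/funext => x /=; rewrite cdfE.
Qed.

(** Probability integral transform: [F X] is uniform. As [F] need not be injective, the set is
    compared with half-lines and intervals whose endpoints are preimages under [F]. *)
Lemma distribution_cdf_itvoo (v : R) : 0 < v <= 1 ->
  distribution P X [set x | 0 < F x < v] = v%:E.
Proof.
move=> /andP[v0 v1].
have mA : measurable [set x | 0 < F x < v].
  rewrite (_ : [set _ | _] = (fun x : R => F x) @^-1` `]0, v[%classic);
    last first.
    by apply/seteqP; split => x /=; rewrite in_itv.
  by rewrite -[X in measurable X]setTI; exact: measurable_fine_cdf.
apply/eqP; rewrite eq_le; apply/andP; split.
  (* Only values strictly between 0 and 1 are known to be attained by [F], so [v = 1] is treated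
     apart. *)
  have [v_lt1|v_ge1] := ltP v 1; last first.
    by rewrite (le_trans (probability_le1 _ _))// lee_fin.
  have [|y Fy] := fine_cdf_surj (u := v); first by rewrite v0.
  apply: (@le_trans _ _ (cdf X y)); last by rewrite cdfE Fy.
  rewrite le_measure ?inE// => x /= /andP[_]; rewrite in_itv/= => Fxv.
  rewrite leNgt; apply/negP => /ltW/fine_cdf_nd.
  by rewrite Fy leNgt Fxv.
apply/lee_addgt0Pr => e e0.
(* If [v <= e] the bound is trivial. Otherwise [F] takes the values [e / 2] at [z] and [v - e / 2]
   at [y], and the interval from [z] to [y] has mass [v - e] and lies in the set. *)
have [ev|ve] := ltP (e / 2) (v / 2); last first.
  rewrite (le_trans (_ : _ <= e%:E)%E) ?lee_fin ?leeDr//; lra.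
have [|z Fz] := fine_cdf_surj (u := e / 2); first by apply/andP; split; lra.
have [|y Fy] := fine_cdf_surj (u := v - e / 2); first by apply/andP; split; lra.
have zy : z <= y.
  rewrite leNgt; apply/negP => /ltW/fine_cdf_nd/=.
  by rewrite Fz Fy; lra.
rewrite (_ : v%:E = (distribution P X `]z, y] + e%:E)%E); last first.
  by rewrite distribution_itvoc// Fz Fy -EFinD; congr EFin; lra.
rewrite leeD2r// le_measure ?inE//= => x /=; rewrite in_itv/= => /andP[zx xy].
have := fine_cdf_nd (ltW zx); have := fine_cdf_nd xy; rewrite /= Fz Fy.
by move=> *; apply/andP; split; lra.
Qed.

(* lebesgue_measure lives on measurableTypeR R, which carries the same
   sigma-algebra as R but a different display; X' is X with that codomain. *)
Let X' : T -> measurableTypeR R := X.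
Let mX' : measurable_fun [set: T] X'.
Proof. exact: (@measurable_funP _ _ _ _ _ X). Qed.

HB.instance Definition _ := isMeasurableFun.Build _ _ _ _ X' mX'.

Let Y : T -> measurableTypeR R := fun t => - ln (F (X t)).
Let mlnF : measurable_fun [set: R] (fun x => - ln (F x)).
Proof.
apply: measurableT_comp => //.
apply: measurableT_comp; [exact: measurable_ln|exact: measurable_fine_cdf].
Qed.
Let mY : measurable_fun [set: T] Y.
Proof.
exact: (@measurableT_comp _ _ _ _ _ _ (fun x => - ln (F x))).
Qed.
HB.instance Definition _ := isMeasurableFun.Build _ _ _ _ Y mY.

Lemma distribution_opp_ln_cdf (t : R) : 0 <= t ->
  distribution P (Y : {RV P >-> measurableTypeR R}) `]t, +oo[ = (expR (- t))%:E.
Proof.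
move=> t0.
rewrite -(@distribution_cdf_itvoo (expR (- t))) ?expR_gt0 ?expR_le1 ?oppr_le0//.
rewrite /distribution /pushforward; congr (P _).
apply/seteqP; split => s /=; rewrite in_itv/= andbT /Y ltrNr.
  (* Where [F] is 0, the default [ln 0 = 0] gives [Y] the value 0, which does not exceed [t]; such
     points belong to neither set. *)
  have := fine_cdf_ge0 (X s); rewrite le_eqVlt => /predU1P[<-|F0].
    rewrite ln0// => h; move: t0; rewrite leNgt => /negP; lra.
  by rewrite F0/= -{2}(lnK F0) ltr_expR.
by move=> /andP[F0]; rewrite -{1}(lnK F0) ltr_expR.
Qed.

(** Both sides are the expectation of [g] at [- ln (F X)], computed first with the density of [X]
    and then with the exponential density. This changes variables without differentiating [F]. *)
Lemma ge0_integral_pdf_comp_opp_ln_cdf (g : R -> R) :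
  measurable_fun [set: R] g -> (forall x, 0 <= g x) ->
  (\int[mu]_x (g (- ln (F x)) * f x)%:E =
   \int[mu]_x (g x * exponential_pdf 1 x)%:E)%E.
Proof.
move=> mg g0.
have mgl : measurable_fun [set: R] (fun x => g (- ln (F x))).
  exact: (@measurableT_comp _ _ _ _ _ _ g).
rewrite -(@ge0_integral_density _ _ _ mu
  (distribution P (X' : {RV P >-> measurableTypeR R})) f)//.
rewrite (@ge0_integral_distribution _ _ _ _ _ P X'
  (fun x => (g (- ln (F x)))%:E))//; last 2 first.
- exact/measurable_EFinP.
- by move=> y; rewrite lee_fin.
rewrite -(@ge0_integral_density _ _ _ mu
  (distribution P (Y : {RV P >-> measurableTypeR R})))//.
- by rewrite ge0_integral_distribution//; exact/measurable_EFinP.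
- exact: measurable_exponential_pdf.
- by move=> x; exact: exponential_pdf_ge0.
- by apply: exponential_law; exact: distribution_opp_ln_cdf.
Qed.

End cdf_of_pdf.

(** * Densities of the lower record values *)

Section lower_record.
Context d (T : measurableType d) (R : realType) (P : probability T R).
Variables (X : {RV P >-> R}) (f : R -> R) (k : nat).
Hypothesis f_pdf : is_pdf X f.
Hypothesis k_gt0 : (0 < k)%N.

Local Notation mu := (@lebesgue_measure R).
Local Notation F x := (fine (cdf X x)).
Local Notation fL := (lower_record_pdf (fun x => F x) f k).

Let mf : measurable_fun [set: R] f. Proof. by case: f_pdf. Qed.
Let f_ge0 (x : R) : 0 <= f x. Proof. by case: f_pdf. Qed.
Let fE (A : set R) : measurable A ->
  (distribution P X A = \int[mu]_(x in A) (f x)%:E)%E.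
Proof. by case: f_pdf => _ _; exact. Qed.
Let mF : measurable_fun [set: R] (fun x => F x).
Proof. exact: measurable_fine_cdf. Qed.

(* Rules out, up to a null set, the points of the support where F x = 0 and
   ln (F x) takes its junk value 0. *)
Lemma ae_pdf_gt0_cdf_gt0 : {ae mu, forall x, 0 < f x -> 0 < F x}.
Proof.
have mF0 : measurable [set x | F x = 0].
  rewrite (_ : [set _ | _] = (fun x : R => F x) @^-1` [set 0])//.
  by rewrite -[X in measurable X]setTI; exact: mF.
have mF01 : measurable [set x | 0 < F x < 1].
  rewrite (_ : [set _ | _] = (fun x : R => F x) @^-1` `]0, 1[%classic);
    last first.
    by apply/seteqP; split => x /=; rewrite in_itv.
  by rewrite -[X in measurable X]setTI; exact: mF.
(* By uniformity with [v = 1], the points where [0 < F x < 1] carry all the mass; the nonnegative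
   [f] then integrates to 0 over the zero set of [F]. *)
have PF0 : distribution P X [set x | F x = 0] = 0%E.
  apply/eqP; rewrite eq_le measure_ge0 andbT.
  have -> : 0%E = distribution P X (~` [set x | 0 < F x < 1]).
    rewrite probability_setC//.
    rewrite [X in (_ - X)%E](_ : _ = 1%E) ?subee//.
    by apply: (distribution_cdf_itvoo f_pdf); rewrite ltr01 lexx.
  rewrite le_measure ?inE//; first exact: measurableC.
  by move=> x /= ->; rewrite ltxx.
have : ae_eq mu [set x | F x = 0] (EFin \o f) (cst 0%E).
  apply/ae_eq_integral_abs => //; first exact/measurable_EFinP/measurable_funTS.
  rewrite -[RHS]PF0 fE//; apply: eq_integral => x _ /=.
  by rewrite ger0_norm.
apply: filterS => x /= fx0 f_gt0.
have := fine_cdf_ge0 X x; rewrite le_eqVlt => /predU1P[/esym/fx0[fx]|//].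
by move: f_gt0; rewrite fx ltxx.
Qed.

Lemma lower_record_pdf_ge0 n x : 0 <= fL n x.
Proof.
rewrite /lower_record_pdf !mulr_ge0 ?exprn_ge0 ?invr_ge0//.
  by rewrite oppr_ge0 ln_le0// fine_cdf_le1.
exact: fine_cdf_ge0.
Qed.

Lemma measurable_lower_record_pdf n : measurable_fun [set: R] (fL n).
Proof.
apply: measurable_funM => //; apply: measurable_funM; last first.
  exact: measurable_funX.
apply: measurable_funM => //; apply: measurable_funX.
apply: measurableT_comp => //.
by apply: measurableT_comp; [exact: measurable_ln|exact: mF].
Qed.

Lemma integral_lower_record_pdf n : (0 < n)%N ->
  (\int[mu]_x (fL n x)%:E = 1)%E.
Proof.
case: n => // n _.
(* This is the factor of [f] in the record density, written in t = -ln F, with F^(k-1) = exp (-(k-1)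
   t). The absolute value makes [g] nonnegative everywhere and is harmless, since -ln F >= 0. *)
pose g (t : R) := k%:R ^+ n.+1 / n`!%:R * `|t| ^+ n * expR (- (k.-1%:R * t)).
have g_ge0 t : 0 <= g t.
  by rewrite /g !mulr_ge0 ?exprn_ge0 ?invr_ge0 ?expR_ge0.
have mg : measurable_fun [set: R] g.
  apply: measurable_funM.
    by apply: measurable_funM => //; apply: measurable_funX;
      exact: normr_measurable.
  apply: measurableT_comp; first exact: measurable_expR.
  by apply: measurableT_comp => //; exact: measurable_funM.
transitivity (\int[mu]_x (g (- ln (F x)) * f x)%:E)%E.
  apply: ge0_ae_eq_integral => //.
  - have h : measurable_fun [set: R] (EFin \o fL n.+1).
      apply/measurable_EFinP; exact: measurable_lower_record_pdf.
    exact: h.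
  - have h : measurable_fun [set: R] (EFin \o (fun x => g (- ln (F x)) * f x)).
      apply/measurable_EFinP/measurable_funM => //.
      apply: (@measurableT_comp _ _ _ _ _ _ g) => //.
      apply: measurableT_comp => //.
      by apply: measurableT_comp; [exact: measurable_ln|exact: mF].
    exact: h.
  - by move=> x _; rewrite lee_fin lower_record_pdf_ge0.
  - by move=> x _; rewrite lee_fin mulr_ge0.
  have [N [mN N0 fFN]] := ae_pdf_gt0_cdf_gt0.
  exists N; split => //; apply: subset_trans fFN => x /= h fF; apply: h => _.
  congr EFin.
  rewrite /lower_record_pdf /g/=.
  have := f_ge0 x; rewrite le_eqVlt => /predU1P[<-|/fF F_gt0].
    by rewrite !mulr0.
  congr (_ * _ * _ * _).
    by rewrite ger0_norm// oppr_ge0 ln_le0// fine_cdf_le1.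
  by rewrite mulrN opprK expRM_natl lnK.
(* The factor exp (-t) of the exponential density raises the rate from k - 1 to k, which yields the
   Erlang density on the nonnegative half-line. *)
rewrite (ge0_integral_pdf_comp_opp_ln_cdf f_pdf)//.
rewrite -(@integral_erlang R k%:R _ n) ?ltr0n// [RHS]integral_mkcond.
apply: eq_integral => x _; rewrite patchE; case: ifPn; last first.
  rewrite notin_setE/= in_itv/= andbT => /negP; rewrite -ltNge => x0.
  by rewrite lt0_exponential_pdf// mulr0.
rewrite inE/= in_itv/= andbT => x0.
rewrite exponential_pdfE// /g ger0_norm// mul1r mulN1r.
rewrite -(mulrA _ _ (expR (- x))) -expRD.
congr (_ * expR _)%:E; rewrite -opprD; congr (- _).
by rewrite -[in RHS](prednK k_gt0) -nat1r; ring.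
Qed.

Lemma integrable_lower_record_pdf n : (0 < n)%N ->
  mu.-integrable [set: R] (EFin \o fL n).
Proof.
move=> n0; apply/integrableP; split.
  by apply/measurable_EFinP; exact: measurable_lower_record_pdf.
under eq_integral do rewrite /= ger0_norm ?lower_record_pdf_ge0//.
by rewrite integral_lower_record_pdf// ltry.
Qed.

Lemma lower_record_pdfS n x : (0 < n)%N ->
  fL n.+1 x = k%:R / n%:R * - ln (F x) * fL n x.
Proof.
case: n => // n _; rewrite /lower_record_pdf/= factS natrM !exprS.
by field; rewrite nat1r !pnatr_eq0 -!lt0n fact_gt0.
Qed.

(** There is mass on both sides of [x], so [f] is positive at some point [<= x] and at some point
    [>= x]; the interval hypothesis then captures [x]. *)
Lemma pdf_support_cdf_itvoo (x : R) : is_interval (pdf_support f) ->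
  0 < F x < 1 -> pdf_support f x.
Proof.
move=> itvf /andP[F0 F1].
have [y [yx fy]] : exists y, y <= x /\ 0 < f y.
  apply: contrapT => /forallNP nf; move: F0.
  rewrite /cdf fE// integral0_eq ?ltxx// => y /=; rewrite in_itv/= => yx.
  congr EFin; apply/eqP; rewrite eq_le f_ge0 andbT leNgt; apply/negP => fy.
  exact: (nf y).
have [z [xz fz]] : exists z, x <= z /\ 0 < f z.
  apply: contrapT => /forallNP nf; move: F1.
  have := cdf_ccdf_1 X x; rewrite /ccdf fE// integral0_eq.
    by rewrite adde0 => ->; rewrite /= ltxx.
  move=> z /=; rewrite in_itv/= andbT => /ltW xz.
  congr EFin; apply/eqP; rewrite eq_le f_ge0 andbT leNgt; apply/negP => fz.
  exact: (nf z).
by apply: (itvf y z) => //; rewrite yx xz.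
Qed.

End lower_record.

(** * Comparison of consecutive inaccuracies *)

Theorem theorem2 (d : measure_display) (T : measurableType d) (R : realType)
    (P : probability T R) (X : {RV P >-> R}) (fX : R -> R) (k : nat)
    (FX := fun x : R => fine (cdf X x))
    (fL := lower_record_pdf FX fX k)
    (k_gt0 : (0 < k)%N)
    (fX_pdf : is_pdf X fX)
    (supp_itv : is_interval (pdf_support fX))
    (fX_incr : forall x y : R, pdf_support fX x -> pdf_support fX y ->
       x <= y -> fX x <= fX y)
    (H_wd : forall n : nat, (0 < n)%N -> kerridge_well_defined (fL n) fX)
    (n : nat) (n_gt0 : (0 < n)%N) :
  (kerridge (fL n) fX <= kerridge (fL n.+1) fX)%E.
Proof.
have kR : 0 < k%:R :> R by rewrite ltr0n.
have nR : 0 < n%:R :> R by rewrite ltr0n.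
have [x0 Fx0] : exists x0, FX x0 = expR (- (n%:R / k%:R)).
  apply: (fine_cdf_surj fX_pdf).
  by rewrite expR_gt0 expR_lt1 oppr_lt0 divr_gt0.
(* Monotonicity of [fX] is assumed on the support only, so [x0] has to lie there to serve as a point
   of comparison. *)
have fx0 : pdf_support fX x0.
  apply: (pdf_support_cdf_itvoo fX_pdf supp_itv); rewrite -/(FX x0) Fx0.
  by rewrite expR_gt0 expR_lt1 oppr_lt0 divr_gt0.
have mf : measurable_fun [set: R] fX by case: fX_pdf.
have f_ge0 x : 0 <= fX x by case: fX_pdf.
have mfL m : measurable_fun [set: R] (fL m).
  exact: (measurable_lower_record_pdf k fX_pdf).
have ifL m : (0 < m)%N -> lebesgue_measure.-integrable [set: R] (EFin \o fL m).
  exact: (integrable_lower_record_pdf fX_pdf k_gt0).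
have mlnf : measurable_fun [set: R] (fun x => ln (fX x)).
  by apply: measurableT_comp => //; exact: measurable_ln.
rewrite /kerridge leeN2 /kerridge_integrand.
have ie := integrableB measurableT (ifL n.+1 isT) (ifL n n_gt0).
(* Subtracting [c] from the logarithm costs the term [c * (fL n.+1 x - fL n x)], whose integral is 0
   because both densities have mass 1. *)
pose c := ln (fX x0).
apply: (@le_integral_perturbed _ _ _ lebesgue_measure
  (fun x => fL n.+1 x * ln (fX x)) (fun x => fL n x * ln (fX x))
  (fun x => c * (fL n.+1 x - fL n x))).
- by apply: measurable_funM; [exact: mfL|exact: mlnf].
- by apply: measurable_funM; [exact: mfL|exact: mlnf].
- exact: integrableZl ie.
- rewrite (integralZl _ ie)// integralB//; [|exact: ifL|exact: ifL].
  by rewrite !(integral_lower_record_pdf fX_pdf)// subee// mule0.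
- have [N [mN N0 fFN]] := ae_pdf_gt0_cdf_gt0 fX_pdf.
  exists N; split => //; apply: subset_trans fFN => x /= h fF; apply: h.
  suff : (fL n.+1 x - fL n x) * (ln (fX x) - c) <= 0 by lra.
  have := f_ge0 x; rewrite le_eqVlt => /predU1P[fx|fx].
    by rewrite /fL /lower_record_pdf -fx !mulr0 subrr mul0r.
  have Fx := fF fx.
  have fLn := lower_record_pdf_ge0 k fX_pdf n x.
  rewrite -/(fL n x) in fLn.
  rewrite /fL lower_record_pdfS// -/(fL n x) -/(FX x).
  rewrite -{2}[fL n x]mul1r -mulrBl mulrAC; apply: mulr_le0_ge0 => //.
  have lnFx0 : ln (FX x0) = - (n%:R / k%:R) by rewrite Fx0 expRK.
  have Fx0_gt0 : 0 < FX x0 by rewrite Fx0 expR_gt0.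
  have E : k%:R / n%:R * - ln (FX x) - 1 =
      k%:R / n%:R * (ln (FX x0) - ln (FX x)).
    by rewrite lnFx0; field; rewrite !gt_eqF.
  rewrite E -(mulrA (_ / _)); apply: mulr_ge0_le0.
    by rewrite divr_ge0// ltW.
  (* [FX] and [fX] are both monotone, so the two differences of logarithms, taken in opposite
     orders, have opposite signs on either side of [x0]. *)
  have [xx0|/ltW x0x] := leP x x0.
    apply: mulr_ge0_le0; rewrite ?subr_ge0 ?subr_le0 ler_ln ?posrE//.
      exact: fine_cdf_nd.
    exact: fX_incr.
  apply: mulr_le0_ge0; rewrite ?subr_ge0 ?subr_le0 ler_ln ?posrE//.
    exact: fine_cdf_nd.
  exact: fX_incr.
- exact: H_wd.
- exact: H_wd.
Qed.
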